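(* Let $n,m,p,q,n_z$ be positive integers, $A\in\mathbb{R}^{n\times n}$, $C\in\mathbb{R}^{p\times n}$, $B_w\in\mathbb{R}^{n\times q}$, $D_w\in\mathbb{R}^{p\times q}$, $Z\in\mathbb{R}^{n_z\times n}$, with the pair $(A,C)$ detectable. Let $f:\mathbb{R}^n\times\mathbb{R}^m\to\mathbb{R}^n$ be Lipschitz in its first argument on $\mathcal{X}\times\mathcal{U}\subset\mathbb{R}^n\times\mathbb{R}^m$ with constant $\gamma\in\mathbb{R}_+$, i.e. $\|f(x,u)-f(\hat x,u)\|_2\le\gamma\|x-\hat x\|_2$ for all $x,\hat x\in\mathcal{X}$ and $u\in\mathcal{U}$. Consider the system $$x[k+1]=Ax[k]+f(x[k],u[k])+B_w w[k],\qquad y[k]=Cx[k]+D_w w[k],$$ with disturbance $w\in\mathcal{L}_\infty$, and the observer with gain $L\in\mathbb{R}^{n\times p}$ $$\hat x[k+1]=A\hat x[k]+f(\hat x[k],u[k])+L(y[k]-\hat y[k]),\qquad \hat y[k]=C\hat x[k],$$ where $x[k],\hat x[k]\in\mathcal{X}$ and $u[k]\in\mathcal{U}$ for all $k$. Suppose that $P\in\mathbb{S}^n_{++}$, $Y\in\mathbb{R}^{n\times p}$, $\epsilon,\mu_0,\mu_1,\mu_2\in\mathbb{R}_+$ and $\alpha\in\mathbb{R}_{++}$ exist that solve the optimization problem $$\min_{P,Y,\epsilon,\alpha,\mu_0,\mu_1,\mu_2}\ \mu_0\mu_1+\mu_2$$ subject to $$\begin{bmatrix}(\alpha-1)P+\epsilon\gamma^2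 I & * & * & *\\ PA-YC & P-\epsilon I & * & *\\ O & \Phi^\top & -\alpha\mu_0 I & *\\ PA-YC & O & \Phi & -P\end{bmatrix}\preceq 0,\qquad \begin{bmatrix}-P & * & *\\ O & -\mu_2 I & *\\ Z & O & -\mu_1 I\end{bmatrix}\preceq 0,$$ where $\Phi:=PB_w-YD_w$. Then, with observer gain $L=P^{-1}Y$, the estimation error dynamics $$e[k+1]=(A-LC)e[k]+\Delta f[k]+(B_w-LD_w)w[k],\qquad e[k]:=x[k]-\hat x[k],\quad \Delta f[k]:=f(x[k],u[k])-f(\hat x[k],u[k]),$$ with performance output $z[k]=Ze[k]$, is $\mathcal{L}_\infty$ stable with performance level $\mu=\sqrt{\mu_0\mu_1+\mu_2}$.
   Context: Notation: $\mathbb{S}^n_{++}$ is the set of real symmetric positive definite $n\times n$ matrices; $\mathbb{R}_+$ denotes the nonnegative reals and $\mathbb{R}_{++}$ the positive reals; $\|\cdot\|_2$ is the Euclidean norm; $M\preceq 0$ means $M$ is symmetric negative semidefinite; $*$ denotes the blocks determined by symmetry of a symmetric block matrix; $O$ is a zero matrix and $I$ an identity matrix of appropriate size. Time $k$ ranges over the nonnegative integers. $w\in\mathcal{L}_\infty$ means $w:k\mapsto w[k]\in\mathbb{R}^q$ is bounded, with $\|w\|_{\mathcal{L}_\infty}:=\sup_{k\ge0}\|w[k]\|_2<\infty$. The set $\mathcal{X}$ is the operating region of the states and $\mathcal{U}$ that of the known inputs $u$. $\mathcal{L}_\infty$ stability: the error dynamics with performance output $z=Ze$ is $\mathcal{L}_\infty$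 stable with performance level $\mu$ if the following hold (for all trajectories staying in the operating region): (1) with $w\equiv 0$, the error dynamics is uniformly exponentially stable about the origin, i.e. there are constants $c\ge 1$ and $\lambda\in[0,1)$, independent of the trajectory, such that $\|e[k]\|_2\le c\lambda^k\|e[0]\|_2$ for all $k\ge0$; (2) there is a function $\beta:\mathbb{R}^n\times\mathbb{R}_+\to\mathbb{R}_+$ such that for every initial error $e[0]$ and every $w\in\mathcal{L}_\infty$, $\|e[k]\|_2\le\beta(e[0],\|w\|_{\mathcal{L}_\infty})$ for all $k\ge 0$; (3) for $e[0]=0$ and every $w\in\mathcal{L}_\infty$, $\|z[k]\|_2\le\mu\|w\|_{\mathcal{L}_\infty}$ for all $k\ge0$; (4) for every initial error $e[0]$ and every $w\in\mathcal{L}_\infty$, $\limsup_{k\to\infty}\|z[k]\|_2\le\mu\|w\|_{\mathcal{L}_\infty}$. *)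

(* Defs.v *)
From HB Require Import structures.
From mathcomp Require Import all_boot all_order all_algebra.
From mathcomp Require Import all_classical all_reals all_analysis.
From mathcomp Require Import complex ring.

Set Implicit Arguments.
Unset Strict Implicit.
Unset Printing Implicit Defensive.

Import Order.TTheory GRing.Theory Num.Theory.
Local Open Scope classical_set_scope.
Local Open Scope ring_scope.

(* The library norm on matrices is the max norm, hence this definition. *)
Definition norm2 (R : realType) (n : nat) (v : 'cV[R]_n) : R :=
  Num.sqrt (\sum_(i < n) v i 0 ^+ 2).

Definition quad_form (R : realType) (n : nat) (M : 'M[R]_n) (v : 'cV[R]_n) : R :=
  (v^T *m M *m v) 0 0.

Definition posdef (R : realType) (n : nat) (M : 'M[R]_n) : Prop :=
  M^T = M /\ forall v : 'cV[R]_n, v != 0 -> 0 < quad_form M v.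

Definition negsemidef (R : realType) (n : nat) (M : 'M[R]_n) : Prop :=
  M^T = M /\ forall v : 'cV[R]_n, quad_form M v <= 0.

(* The block matrix [M11 *; M21 M22], with the starred block fixed by symmetry. *)
Definition sym_block (R : realType) (n1 n2 : nat)
    (M11 : 'M[R]_n1) (M21 : 'M[R]_(n2, n1)) (M22 : 'M[R]_n2) : 'M[R]_(n1 + n2) :=
  block_mx M11 M21^T M21 M22.

(* Discrete time: the whole complex spectrum lies in the open unit disc. *)
Definition schur_stable (R : realType) (n : nat) (M : 'M[R]_n) : Prop :=
  forall a : R[i], eigenvalue (map_mx (real_complex R) M) a -> `|a| < 1.

Definition detectable (R : realType) (n p : nat)
    (A : 'M[R]_n) (C : 'M[R]_(p, n)) : Prop :=
  exists L : 'M[R]_(n, p), schur_stable (A - L *m C).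

Definition lipschitz_fst (R : realType) (n m : nat)
    (f : 'cV[R]_n -> 'cV[R]_m -> 'cV[R]_n)
    (X : set 'cV[R]_n) (U : set 'cV[R]_m) (gamma : R) : Prop :=
  forall x xh u, X x -> X xh -> U u ->
    norm2 (f x u - f xh u) <= gamma * norm2 (x - xh).

Definition bounded_signal (R : realType) (q : nat) (w : nat -> 'cV[R]_q) : Prop :=
  has_ubound (range (fun k => norm2 (w k))).

(* Meaningful for bounded signals only: [sup] is 0 on unbounded sets. *)
Definition norm_Linf (R : realType) (q : nat) (w : nat -> 'cV[R]_q) : R :=
  sup (range (fun k => norm2 (w k))).

Definition plant (R : realType) (n m p q : nat)
    (A : 'M[R]_n) (C : 'M[R]_(p, n)) (Bw : 'M[R]_(n, q)) (Dw : 'M[R]_(p, q))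
    (f : 'cV[R]_n -> 'cV[R]_m -> 'cV[R]_n)
    (x : nat -> 'cV[R]_n) (u : nat -> 'cV[R]_m) (w : nat -> 'cV[R]_q)
    (y : nat -> 'cV[R]_p) : Prop :=
  forall k, x k.+1 = A *m x k + f (x k) (u k) + Bw *m w k /\
            y k = C *m x k + Dw *m w k.

Definition observer (R : realType) (n m p : nat)
    (A : 'M[R]_n) (C : 'M[R]_(p, n)) (f : 'cV[R]_n -> 'cV[R]_m -> 'cV[R]_n)
    (L : 'M[R]_(n, p))
    (xh : nat -> 'cV[R]_n) (u : nat -> 'cV[R]_m) (y : nat -> 'cV[R]_p) : Prop :=
  forall k, xh k.+1 = A *m xh k + f (xh k) (u k) + L *m (y k - C *m xh k).

(* [e] is an estimation error produced under the disturbance [w] by some run of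
   plant and observer that stays in the operating region. *)
Definition error_trajectory (R : realType) (n m p q : nat)
    (A : 'M[R]_n) (C : 'M[R]_(p, n)) (Bw : 'M[R]_(n, q)) (Dw : 'M[R]_(p, q))
    (f : 'cV[R]_n -> 'cV[R]_m -> 'cV[R]_n)
    (X : set 'cV[R]_n) (U : set 'cV[R]_m) (L : 'M[R]_(n, p))
    (e : nat -> 'cV[R]_n) (w : nat -> 'cV[R]_q) : Prop :=
  exists (x xh : nat -> 'cV[R]_n) (u : nat -> 'cV[R]_m) (y : nat -> 'cV[R]_p),
    [/\ plant A C Bw Dw f x u w y,
        observer A C f L xh u y,
        forall k, [/\ X (x k), X (xh k) & U (u k)]
      & forall k, e k = x k - xh k].

(* Along a run of the plant, [xh] obeys the observer equation if and only if
   [x - xh] obeys the error recursion, so that [error_trajectory] describes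
   exactly the error dynamics. *)
Lemma observer_error_recursion (R : realType) (n m p q : nat)
    (A : 'M[R]_n) (C : 'M[R]_(p, n)) (Bw : 'M[R]_(n, q)) (Dw : 'M[R]_(p, q))
    (f : 'cV[R]_n -> 'cV[R]_m -> 'cV[R]_n) (L : 'M[R]_(n, p))
    (x xh e : nat -> 'cV[R]_n) (u : nat -> 'cV[R]_m) (w : nat -> 'cV[R]_q)
    (y : nat -> 'cV[R]_p) :
  plant A C Bw Dw f x u w y -> (forall k, e k = x k - xh k) ->
  observer A C f L xh u y <->
  (forall k, e k.+1 = (A - L *m C) *m e k + (f (x k) (u k) - f (xh k) (u k))
                      + (Bw - L *m Dw) *m w k).
Proof.
move=> Hp He.
have key k : (A - L *m C) *m e k + (f (x k) (u k) - f (xh k) (u k))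
      + (Bw - L *m Dw) *m w k
    = x k.+1 - (A *m xh k + f (xh k) (u k) + L *m (y k - C *m xh k)).
  have [-> ->] := Hp k.
  rewrite He !mulmxBl !mulmxBr !mulmxDr -!mulmxA.
  by apply/matrixP => i j; rewrite !mxE; ring.
split=> H k; first by rewrite key -H He.
by apply/oppr_inj/(addrI (x k.+1)); rewrite -key -H He.
Qed.

(* [T e w] says that [e] is a trajectory of the error dynamics under the
   disturbance [w]; the performance output is [Z *m e k]. *)
Definition Linf_stable (R : realType) (n q nz : nat)
    (T : (nat -> 'cV[R]_n) -> (nat -> 'cV[R]_q) -> Prop)
    (Z : 'M[R]_(nz, n)) (mu : R) : Prop :=
  [/\ exists c lambda : R,
        [/\ 1 <= c, 0 <= lambda < 1
          & forall e, T e (fun=> 0) ->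
              forall k, norm2 (e k) <= c * lambda ^+ k * norm2 (e 0%N)],
      exists beta : 'cV[R]_n -> R -> R,
        (forall e0 r, 0 <= r -> 0 <= beta e0 r) /\
        (forall e w, T e w -> bounded_signal w ->
           forall k, norm2 (e k) <= beta (e 0%N) (norm_Linf w)),
      forall e w, T e w -> bounded_signal w -> e 0%N = 0 ->
        forall k, norm2 (Z *m e k) <= mu * norm_Linf w
    & forall e w, T e w -> bounded_signal w ->
        (limn_esup (fun k => (norm2 (Z *m e k))%:E) <= (mu * norm_Linf w)%:E)%E].

Definition lmi_state (R : realType) (n p q : nat)
    (A : 'M[R]_n) (C : 'M[R]_(p, n)) (Bw : 'M[R]_(n, q)) (Dw : 'M[R]_(p, q))
    (gamma : R) (P : 'M[R]_n) (Y : 'M[R]_(n, p)) (eps alpha mu0 : R)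
    : 'M[R]_((n + n) + (q + n)) :=
  let Phi := P *m Bw - Y *m Dw in
  let Psi := P *m A - Y *m C in
  sym_block
    (sym_block ((alpha - 1) *: P + (eps * gamma ^+ 2)%:M) Psi (P - eps%:M))
    (block_mx 0 Phi^T
              Psi 0)
    (sym_block (- (alpha * mu0)%:M) Phi (- P)).

Definition lmi_output (R : realType) (n q nz : nat)
    (Z : 'M[R]_(nz, n)) (P : 'M[R]_n) (mu1 mu2 : R) : 'M[R]_((n + q) + nz) :=
  sym_block (sym_block (- P) 0 (- mu2%:M)) (row_mx Z 0) (- mu1%:M).

Definition feasible (R : realType) (n p q nz : nat)
    (A : 'M[R]_n) (C : 'M[R]_(p, n)) (Bw : 'M[R]_(n, q)) (Dw : 'M[R]_(p, q))
    (Z : 'M[R]_(nz, n)) (gamma : R)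
    (P : 'M[R]_n) (Y : 'M[R]_(n, p)) (eps alpha mu0 mu1 mu2 : R) : Prop :=
  [/\ posdef P,
      [/\ 0 <= eps, 0 < alpha, 0 <= mu0, 0 <= mu1 & 0 <= mu2],
      negsemidef (lmi_state A C Bw Dw gamma P Y eps alpha mu0)
    & negsemidef (@lmi_output R n q nz Z P mu1 mu2)].

Definition solves_min (R : realType) (n p q nz : nat)
    (A : 'M[R]_n) (C : 'M[R]_(p, n)) (Bw : 'M[R]_(n, q)) (Dw : 'M[R]_(p, q))
    (Z : 'M[R]_(nz, n)) (gamma : R)
    (P : 'M[R]_n) (Y : 'M[R]_(n, p)) (eps alpha mu0 mu1 mu2 : R) : Prop :=
  feasible A C Bw Dw Z gamma P Y eps alpha mu0 mu1 mu2 /\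
  forall P' Y' eps' alpha' mu0' mu1' mu2',
    feasible A C Bw Dw Z gamma P' Y' eps' alpha' mu0' mu1' mu2' ->
    mu0 * mu1 + mu2 <= mu0' * mu1' + mu2'.

(* Main.v *)
Require Import Defs.
From mathcomp Require Import all_boot all_order all_algebra.
From mathcomp Require Import all_classical all_reals all_analysis.
From mathcomp Require Import ring lra.
Import Order.TTheory GRing.Theory Num.Theory numFieldNormedType.Exports.
Local Open Scope classical_set_scope.
Local Open Scope ring_scope.

(** Put [V e = e^T P e].  Evaluating the first LMI at [(e, d, w, g)], where
    [d = Delta f] and [g = (A - L C) e + (Bw - L Dw) w] satisfies
    [P g = (P A - Y C) e + Phi w], is the Schur complement step in disguise: it
    gives
    [V (g + d) <= (1 - alpha) V e + eps (|d|^2 - gamma^2 |e|^2) + alpha mu0 |w|^2],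
    and the Lipschitz bound removes the middle term.  Hence
    [V (e k) <= (1 - alpha)^k V (e 0) + mu0 |w|^2].  The second LMI, evaluated at
    [(e, 0, t Z e)], gives [|Z e|^2 <= mu1 V e]. *)

(** * Bilinear forms, the Euclidean norm and positive definite matrices *)

Section BilinearForm.
Set Implicit Arguments.
Unset Strict Implicit.
Variable R : realType.

Definition bil (m n : nat) (M : 'M[R]_(m, n)) (u : 'cV[R]_m) (v : 'cV[R]_n) : R :=
  (u^T *m M *m v) 0 0.

Lemma quad_formE (n : nat) (M : 'M[R]_n) (v : 'cV[R]_n) :
  quad_form M v = bil M v v.
Proof. by []. Qed.

Lemma bilDm (m n : nat) (M N : 'M[R]_(m, n)) u v :
  bil (M + N) u v = bil M u v + bil N u v.
Proof. by rewrite /bil mulmxDr mulmxDl mxE. Qed.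

Lemma bilNm (m n : nat) (M : 'M[R]_(m, n)) u v : bil (- M) u v = - bil M u v.
Proof. by rewrite /bil mulmxN mulNmx mxE. Qed.

Lemma bilZm (m n : nat) a (M : 'M[R]_(m, n)) u v :
  bil (a *: M) u v = a * bil M u v.
Proof. by rewrite /bil -scalemxAr -scalemxAl mxE. Qed.

Lemma bil0m (m n : nat) u v : bil (0 : 'M[R]_(m, n)) u v = 0.
Proof. by rewrite /bil mulmx0 mul0mx mxE. Qed.

Lemma bilDl (m n : nat) (M : 'M[R]_(m, n)) u1 u2 v :
  bil M (u1 + u2) v = bil M u1 v + bil M u2 v.
Proof. by rewrite /bil linearD /= !mulmxDl mxE. Qed.

Lemma bilDr (m n : nat) (M : 'M[R]_(m, n)) u v1 v2 :
  bil M u (v1 + v2) = bil M u v1 + bil M u v2.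
Proof. by rewrite /bil mulmxDr mxE. Qed.

Lemma bilZl (m n : nat) (M : 'M[R]_(m, n)) a u v :
  bil M (a *: u) v = a * bil M u v.
Proof. by rewrite /bil linearZ /= -!scalemxAl mxE. Qed.

Lemma bilZr (m n : nat) (M : 'M[R]_(m, n)) a u v :
  bil M u (a *: v) = a * bil M u v.
Proof. by rewrite /bil -scalemxAr mxE. Qed.

Lemma bil0l (m n : nat) (M : 'M[R]_(m, n)) v : bil M 0 v = 0.
Proof. by rewrite /bil trmx0 !mul0mx mxE. Qed.

Lemma bil0r (m n : nat) (M : 'M[R]_(m, n)) u : bil M u 0 = 0.
Proof. by rewrite /bil mulmx0 mxE. Qed.

Lemma bil_tr (m n : nat) (M : 'M[R]_(m, n)) u v : bil M^T v u = bil M u v.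
Proof.
rewrite /bil; have -> : v^T *m M^T *m u = (u^T *m M *m v)^T.
  by rewrite !trmx_mul trmxK mulmxA.
by rewrite mxE.
Qed.

Lemma bil_mulmxr (m n p : nat) (M : 'M[R]_(m, n)) (N : 'M[R]_(n, p)) u v :
  bil (M *m N) u v = bil M u (N *m v).
Proof. by rewrite /bil !mulmxA. Qed.

Lemma bil_block (m1 m2 n1 n2 : nat) (M11 : 'M[R]_(m1, n1)) (M12 : 'M[R]_(m1, n2))
    (M21 : 'M[R]_(m2, n1)) (M22 : 'M[R]_(m2, n2)) u1 u2 v1 v2 :
  bil (block_mx M11 M12 M21 M22) (col_mx u1 u2) (col_mx v1 v2) =
  bil M11 u1 v1 + bil M12 u1 v2 + bil M21 u2 v1 + bil M22 u2 v2.
Proof.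
rewrite /bil tr_col_mx mul_row_block mul_row_col !mulmxDl !mxE; ring.
Qed.

Lemma bil_row (m n1 n2 : nat) (M1 : 'M[R]_(m, n1)) (M2 : 'M[R]_(m, n2)) u v1 v2 :
  bil (row_mx M1 M2) u (col_mx v1 v2) = bil M1 u v1 + bil M2 u v2.
Proof. by rewrite /bil mul_mx_row mul_row_col mxE. Qed.

Lemma quad_sym_block (n1 n2 : nat) (M11 : 'M[R]_n1) (M21 : 'M[R]_(n2, n1))
    (M22 : 'M[R]_n2) u v :
  quad_form (sym_block M11 M21 M22) (col_mx u v) =
  quad_form M11 u + 2 * bil M21 v u + quad_form M22 v.
Proof. rewrite !quad_formE bil_block bil_tr; ring. Qed.

Lemma bil_scalar (n : nat) a (u v : 'cV[R]_n) : bil a%:M u v = a * bil 1%:M u v.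
Proof. by rewrite -bilZm scale_scalar_mx mulr1. Qed.

Lemma norm2_ge0 (n : nat) (v : 'cV[R]_n) : 0 <= norm2 v.
Proof. exact: sqrtr_ge0. Qed.

Lemma norm2_sqr (n : nat) (v : 'cV[R]_n) : norm2 v ^+ 2 = bil 1%:M v v.
Proof.
rewrite sqr_sqrtr; last by apply: sumr_ge0 => i _; exact: sqr_ge0.
by rewrite /bil mulmx1 mxE; apply: eq_bigr => i _; rewrite mxE expr2.
Qed.

Lemma bil_dot (m n : nat) (M : 'M[R]_(m, n)) u v : bil M u v = bil 1%:M u (M *m v).
Proof. by rewrite -bil_mulmxr mul1mx. Qed.

Lemma norm2_le (n : nat) (v : 'cV[R]_n) b : 0 <= b -> norm2 v ^+ 2 <= b ^+ 2 ->
  norm2 v <= b.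
Proof. by move=> b0; rewrite ler_pXn2r ?nnegrE ?norm2_ge0. Qed.

Lemma norm20 (n : nat) : norm2 (0 : 'cV[R]_n) = 0.
Proof. by apply/eqP; rewrite -sqrf_eq0 norm2_sqr bil0r. Qed.

Lemma normr_coord_le (n : nat) (v : 'cV[R]_n) i : `|v i 0| <= norm2 v.
Proof.
rewrite -sqrtr_sqr ler_wsqrtr // (bigD1 i) //= lerDl.
by apply: sumr_ge0 => j _; exact: sqr_ge0.
Qed.

(** Every coordinate of [v] is at most [norm2 v], so the sum of the [|M i j|] suffices. The added 1
    keeps [b] positive, hence invertible, and later makes the overshoot constant at least 1. *)
Lemma quad_form_bounded (n : nat) (M : 'M[R]_n) :
  exists2 b, 1 <= b & forall v, quad_form M v <= b * norm2 v ^+ 2.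
Proof.
exists (1 + \sum_i \sum_j `|M i j|).
  by rewrite lerDl; apply: sumr_ge0 => i _; apply: sumr_ge0.
move=> v; rewrite mulrDl mul1r -[leLHS]add0r lerD ?sqr_ge0 //.
rewrite exchange_big /quad_form mxE mulr_suml; apply: ler_sum => j _ /=.
rewrite mxE !mulr_suml; apply: ler_sum => i _.
rewrite (le_trans (ler_norm _)) // !mxE !normrM -mulrA mulrCA expr2.
by rewrite ler_wpM2l // ler_pM ?normr_coord_le.
Qed.

(** A nonzero row [v] with [v P = 0] would give the quadratic form the value 0 at [v^T]. *)
Lemma posdef_unit (n : nat) (P : 'M[R]_n) : posdef P -> P \in unitmx.
Proof.
move=> [_ Ppos]; rewrite -row_free_unit -kermx_eq0; apply/negPn/negP => /rowV0Pn.
move=> [v /sub_kermxP vP v0]; have := Ppos v^T; rewrite trmx_eq0 => /(_ v0).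
by rewrite /quad_form trmxK vP mul0mx mxE ltxx.
Qed.

Lemma posdef_ge0 (n : nat) (P : 'M[R]_n) v : posdef P -> 0 <= quad_form P v.
Proof.
move=> [_ Ppos]; have [->|/Ppos/ltW //] := eqVneq v 0.
by rewrite quad_formE bil0r.
Qed.

(* Expanding [0 <= V (v - t P^-1 v)] at [t = 1 / b], where [b] bounds the quadratic
   form of [P^-1], avoids eigenvalues and compactness. *)
Lemma posdef_coercive (n : nat) (P : 'M[R]_n) : posdef P ->
  exists2 b, 1 <= b & forall v, norm2 v ^+ 2 <= b * quad_form P v.
Proof.
move=> Pp; have Pu := posdef_unit Pp; have [Psym _] := Pp.
have [b b1 Hb] := quad_form_bounded (invmx P).
exists b => // v; have b0 : 0 < b by lra.
have := posdef_ge0 (v - b^-1 *: (invmx P *m v)) Pp.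
have dotC (u u' : 'cV[R]_n) : bil 1%:M u u' = bil 1%:M u' u by rewrite -bil_tr trmx1.
have Pinv : P *m (invmx P *m v) = v by rewrite mulmxA mulmxV // mul1mx.
rewrite -scaleNr quad_formE !(bilDl, bilDr, bilZl, bilZr).
rewrite -[bil P (invmx P *m v) v]bil_tr Psym.
rewrite ![bil P _ (invmx P *m v)]bil_dot Pinv dotC -bil_dot.
rewrite -norm2_sqr -!quad_formE => H; have Hv := Hb v.
have bV : 0 < b^-1 by rewrite invr_gt0.
(* The term quadratic in [t] uses up at most half of the cross term [2 |v|^2 / b]; what remains is
   [|v|^2 / b <= V v]. *)
have : b^-1 * (b^-1 * quad_form (invmx P) v) <= b^-1 * norm2 v ^+ 2.
  by rewrite ler_pM2l // ler_pdivrMl.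
move=> Hq; rewrite -ler_pdivrMl //; lra.
Qed.

End BilinearForm.

(** * Consequences of the two matrix inequalities along error trajectories *)

Section Dissipation.
Set Implicit Arguments.
Unset Strict Implicit.
Variables (R : realType) (n p q nz : nat).
Variables (A : 'M[R]_n) (C : 'M[R]_(p, n)) (Bw : 'M[R]_(n, q)) (Dw : 'M[R]_(p, q)).
Variables (Z : 'M[R]_(nz, n)) (gamma : R).
Variables (P : 'M[R]_n) (Y : 'M[R]_(n, p)) (eps alpha mu0 mu1 mu2 : R).

Lemma lmi_state_dissipation (e d g : 'cV[R]_n) (w : 'cV[R]_q) :
  P^T = P -> 0 <= eps -> 0 <= gamma ->
  negsemidef (lmi_state A C Bw Dw gamma P Y eps alpha mu0) ->
  P *m g = (P *m A - Y *m C) *m e + (P *m Bw - Y *m Dw) *m w ->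
  norm2 d <= gamma * norm2 e ->
  quad_form P (g + d) <= (1 - alpha) * quad_form P e + alpha * mu0 * norm2 w ^+ 2.
Proof.
move=> Psym eps0 gamma0 [_ /(_ (col_mx (col_mx e d) (col_mx w g)))] H Pg Hd.
have Hd2 : eps * norm2 d ^+ 2 <= eps * (gamma ^+ 2 * norm2 e ^+ 2).
  by rewrite ler_wpM2l // -exprMn ler_pXn2r ?nnegrE ?mulr_ge0 ?norm2_ge0.
(* At [u = g] and [u = d] this collects the off-diagonal terms of the LMI into [2 V g + 2 d^T P g].
   Together with the diagonal terms [- V g] and [V d] they form [V (g + d)]. *)
have Pd u : bil P u g = bil (P *m A - Y *m C) u e + bil (P *m Bw - Y *m Dw) u w.
  by rewrite bil_dot Pg bilDr -!bil_dot.
move: H; rewrite /lmi_state !quad_sym_block bil_block bil_tr bil0m.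
rewrite !quad_formE !(bilDl, bilDr).
rewrite -[bil P g d]bil_tr Psym bilNm !Pd !(bilDm, bilNm, bilZm) bil0m.
rewrite (bil_scalar (eps * _)) (bil_scalar eps) (bil_scalar (alpha * _)).
rewrite -!norm2_sqr; lra.
Qed.

(** The upper left block alone, tested at a nonzero [e], forces [(alpha - 1) V e <= 0]. This makes
    the decay factor [1 - alpha] nonnegative, so that the recursion for [V] can be iterated and the
    factor has a real square root. *)
Lemma lmi_state_decay_le1 :
  (0 < n)%N -> posdef P -> 0 <= eps ->
  negsemidef (lmi_state A C Bw Dw gamma P Y eps alpha mu0) -> alpha <= 1.
Proof.
move=> n0 [_ Ppos] eps0 [_ H]; pose e : 'cV[R]_n := const_mx 1.
have /Ppos Pe : e != 0.
  by apply/eqP => /matrixP/(_ (Ordinal n0) 0); rewrite !mxE; apply/eqP/oner_neq0.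
have := H (col_mx (col_mx e 0) (col_mx 0 0)).
rewrite /lmi_state !quad_sym_block !col_mx0 !quad_formE !bil0l.
rewrite bilDm bilZm bil_scalar -norm2_sqr -quad_formE => He.
have : 0 <= eps * gamma ^+ 2 * norm2 e ^+ 2.
  by apply: mulr_ge0; [apply: mulr_ge0|]; rewrite // sqr_ge0.
by move=> ?; rewrite -subr_ge0 -(pmulr_lge0 _ Pe); lra.
Qed.

Lemma lmi_output_bound (e : 'cV[R]_n) :
  posdef P -> 0 <= mu1 -> negsemidef (@lmi_output R n q nz Z P mu1 mu2) ->
  norm2 (Z *m e) ^+ 2 <= mu1 * quad_form P e.
Proof.
move=> Ppos mu10 [_ H].
have Ht t : (2 * t - mu1 * t ^+ 2) * norm2 (Z *m e) ^+ 2 <= quad_form P e.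
  have := H (col_mx (col_mx e 0) (t *: (Z *m e))).
  rewrite /lmi_output !quad_sym_block bil_row !quad_formE !bil0l !bil0r.
  rewrite !bilNm (bil_scalar mu1) !(bilZl, bilZr) [bil Z _ _]bil_dot -norm2_sqr.
  lra.
have V0 := posdef_ge0 e Ppos; have z0 := sqr_ge0 (norm2 (Z *m e)).
have [mu1E|mu1N] := eqVneq mu1 0.
  (* For [mu1 = 0] the left side of [Ht] is linear in [t]. This [t] would give [2 (V e + 1) <= V e],
     so [Z e] has norm 0. *)
  have := Ht ((quad_form P e + 1) / (norm2 (Z *m e) ^+ 2)).
  rewrite mu1E !mul0r subr0 le_eqVlt.
  have [->//|zN] := eqVneq (norm2 (Z *m e) ^+ 2) 0.
  by rewrite -mulrA mulfVK // => ?; exfalso; lra.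
have mu1_gt0 : 0 < mu1 by rewrite lt_neqAle eq_sym mu1N.
(* [t = 1 / mu1] maximises [2 t - mu1 t^2], with value [1 / mu1]. *)
have := Ht mu1^-1; rewrite -(ler_pM2l mu1_gt0).
have -> // : mu1 * ((2 * mu1^-1 - mu1 * mu1^-1 ^+ 2) * norm2 (Z *m e) ^+ 2) =
  norm2 (Z *m e) ^+ 2 by field.
Qed.

(** The bound propagates because [b] is the fixed point of [s |-> rho s + (1 - rho) b]. It is
    applied with [rho = 1 - alpha] and [b = mu0 W^2]. *)
Lemma affine_recursion_bound (v : nat -> R) rho b :
  0 <= rho -> 0 <= b -> (forall k, v k.+1 <= rho * v k + (1 - rho) * b) ->
  forall k, v k <= rho ^+ k * v 0 + b.
Proof.
move=> rho0 b0 Hv; elim=> [|k IH]; first by rewrite expr0 mul1r lerDl.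
apply: le_trans (Hv k) _; rewrite exprS.
have : rho * v k <= rho * (rho ^+ k * v 0 + b) by rewrite ler_wpM2l.
lra.
Qed.

(** [W] is an arbitrary bound on the disturbance, so that [W = 0] covers the undisturbed case and
    [W = norm_Linf w] the others. *)
Lemma error_lyapunov_bound (m : nat) (f : 'cV[R]_n -> 'cV[R]_m -> 'cV[R]_n)
    (X : set 'cV[R]_n) (U : set 'cV[R]_m) e w W :
  (0 < n)%N -> 0 <= gamma -> lipschitz_fst f X U gamma ->
  feasible A C Bw Dw Z gamma P Y eps alpha mu0 mu1 mu2 ->
  error_trajectory A C Bw Dw f X U (invmx P *m Y) e w ->
  (forall k, norm2 (w k) <= W) ->
  forall k, quad_form P (e k) <= (1 - alpha) ^+ k * quad_form P (e 0) + mu0 * W ^+ 2.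
Proof.
move=> n0 gamma0 f_lip [Ppos [eps0 alpha0 mu00 _ _] Hstate _].
move=> [x [xh [u [y [Hp Ho XU He]]]]] Hw.
have [Psym _] := Ppos; have Pu := posdef_unit Ppos.
have W0 : 0 <= W := le_trans (norm2_ge0 (w 0)) (Hw 0).
have alpha1 := lmi_state_decay_le1 n0 Ppos eps0 Hstate.
apply: affine_recursion_bound; rewrite ?mulr_ge0 ?sqr_ge0 ?subr_ge0 // => k.
(* The gain [L = P^-1 Y] satisfies [P L = Y], which identifies [P g] with the blocks of the LMI. *)
have PY M : P *m (invmx P *m Y *m M) = Y *m M by rewrite !mulmxA mulmxV // mul1mx.
(* [addrAC] moves [Delta f] to the end, so the next error reads [g + d]. *)
rewrite ((observer_error_recursion (invmx P *m Y) Hp He).1 Ho) addrAC.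
apply: le_trans (lmi_state_dissipation Psym eps0 gamma0 Hstate _ _) _.
- by rewrite mulmxDr ![P *m (_ *m _)]mulmxA !mulmxBr !PY.
- by rewrite He; have [Xx Xxh Uu] := XU k; exact: f_lip.
have -> : 1 - (1 - alpha) = alpha by ring.
rewrite lerD2l -[leLHS]mulrA; apply/ler_wpM2l/ler_wpM2l => //; first exact: ltW.
by rewrite ler_pXn2r ?nnegrE ?norm2_ge0.
Qed.

End Dissipation.

(** * Limit superior under a geometrically decaying bound *)

Lemma le_limn_esup (R : realType) (u v : (\bar R)^nat) :
  (forall k, u k <= v k)%E -> (limn_esup u <= limn_esup v)%E.
Proof.
move=> uv; apply: le_ereal_inf_tmp => _ [V FV <-].
apply: (@le_trans _ _ (ereal_sup [set u x | x in V])).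
  by apply: ereal_inf_lbound; exists V.
apply: ge_ereal_sup => _ [k Vk <-].
by apply: le_trans (uv k) _; apply: ereal_sup_ubound; exists k.
Qed.

(** The majorant converges to [b], so its limit superior equals [b]; monotonicity of the limit
    superior transfers the bound to [u]. *)
Lemma limn_esup_le_geometric (R : realType) (u : nat -> R) (a l b : R) :
  0 <= l < 1 -> (forall k, u k <= a * l ^+ k + b) ->
  (limn_esup (fun k => (u k)%:E) <= b%:E)%E.
Proof.
move=> /andP[l0 l1] Hu.
apply: (@le_trans _ _ (limn_esup (fun k => (a * l ^+ k + b)%:E))).
  by apply: le_limn_esup => k; rewrite lee_fin.
have cv : (fun k => (a * l ^+ k + b)%:E) @ \oo --> b%:E.
  apply: cvg_EFin; first by near=> k.
  rewrite -[X in _ --> X]add0r -[X in _ --> X + _](mulr0 a).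
  apply: cvgD; last exact: cvg_cst.
  by apply: cvgM; [exact: cvg_cst|apply: cvg_expr; rewrite ger0_norm].
by rewrite (cvg_limn_einf_sup cv).2.
Unshelve. all: by end_near. Qed.

Lemma norm2_le_norm_Linf (R : realType) (q : nat) (w : nat -> 'cV[R]_q) :
  bounded_signal w -> forall k, norm2 (w k) <= norm_Linf w.
Proof. by move=> Hw k; apply: (ub_le_sup Hw); exists k. Qed.

Theorem theorem1 (R : realType) (n m p q nz : nat)
    (n_gt0 : (0 < n)%N) (m_gt0 : (0 < m)%N) (p_gt0 : (0 < p)%N)
    (q_gt0 : (0 < q)%N) (nz_gt0 : (0 < nz)%N)
    (A : 'M[R]_n) (C : 'M[R]_(p, n)) (Bw : 'M[R]_(n, q)) (Dw : 'M[R]_(p, q))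
    (Z : 'M[R]_(nz, n)) (AC_detectable : detectable A C)
    (f : 'cV[R]_n -> 'cV[R]_m -> 'cV[R]_n)
    (X : set 'cV[R]_n) (U : set 'cV[R]_m)
    (gamma : R) (gamma_ge0 : 0 <= gamma) (f_lip : lipschitz_fst f X U gamma)
    (P : 'M[R]_n) (Y : 'M[R]_(n, p)) (eps alpha mu0 mu1 mu2 : R)
    (sol : solves_min A C Bw Dw Z gamma P Y eps alpha mu0 mu1 mu2) :
  Linf_stable (error_trajectory A C Bw Dw f X U (invmx P *m Y)) Z
    (Num.sqrt (mu0 * mu1 + mu2)).

Proof.
have [feas _] := sol.
have [Ppos [eps0 alpha0 mu00 mu10 mu20] Hstate Hout] := feas.
have alpha1 := lmi_state_decay_le1 n_gt0 Ppos eps0 Hstate.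
set T := error_trajectory _ _ _ _ _ _ _ _.
have VT e w W : T e w -> (forall k, norm2 (w k) <= W) -> forall k,
    quad_form P (e k) <= (1 - alpha) ^+ k * quad_form P (e 0%N) + mu0 * W ^+ 2.
  by move=> Te; exact: error_lyapunov_bound n_gt0 gamma_ge0 f_lip feas Te.
have [b1 b11 Hb1] := quad_form_bounded P.
have [b2 b21 Hb2] := posdef_coercive Ppos.
(* [V] is quadratic in the error and decays by [1 - alpha] per step, so the norm decays by the
   square root. *)
pose lam := Num.sqrt (1 - alpha).
have lam2 k : (1 - alpha) ^+ k = (lam ^+ k) ^+ 2.
  by rewrite -exprM mulnC exprM sqr_sqrtr // subr_ge0.
have lam01 : 0 <= lam < 1.
  by rewrite sqrtr_ge0 -sqrtr1 ltr_sqrt //=; lra.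
have lam0 : 0 <= lam by case/andP: lam01.
have Linf0 (w : nat -> 'cV[R]_q) : bounded_signal w -> 0 <= norm_Linf w.
  by move/norm2_le_norm_Linf/(_ 0%N); exact/le_trans/norm2_ge0.
(* Common source of the two performance bounds: a decaying transient plus the squared performance
   level. The bound on [V] yields [mu0 mu1 |w|^2], and the nonnegative [mu2 |w|^2] is added. *)
have ZT e w : T e w -> bounded_signal w -> forall k, norm2 (Z *m e k) ^+ 2 <=
    mu1 * quad_form P (e 0%N) * (lam ^+ k) ^+ 2 +
    (Num.sqrt (mu0 * mu1 + mu2) * norm_Linf w) ^+ 2.
  move=> Te Hw k; have := lmi_output_bound (e k) Ppos mu10 Hout.
  have := VT _ _ _ Te (norm2_le_norm_Linf Hw) k; rewrite lam2.
  move/(ler_wpM2l mu10) => H1 H2; apply: le_trans H2 (le_trans H1 _).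
  rewrite exprMn sqr_sqrtr ?addr_ge0 ?mulr_ge0 //.
  have : 0 <= mu2 * norm_Linf w ^+ 2 by rewrite mulr_ge0 ?sqr_ge0.
  lra.
split.
(* The constant comes from the chain [|e k|^2 <= b2 V (e k) <= b2 lam^(2k) V (e 0) <= b1 b2 lam^(2k)
   |e 0|^2]. *)
- exists (Num.sqrt (b1 * b2)), lam; split=> //.
    by rewrite -sqrtr1 ler_wsqrtr // mulr_ege1.
  move=> e Te k; apply: norm2_le.
    by rewrite !mulr_ge0 ?sqrtr_ge0 ?exprn_ge0 ?norm2_ge0.
  have := VT _ _ 0 Te _ k; rewrite norm20 => /(_ (fun=> lexx 0)).
  rewrite expr0n mulr0 addr0 lam2 => H.
  apply: le_trans (Hb2 _) _.
  rewrite !exprMn sqr_sqrtr; last by rewrite mulr_ge0; lra.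
  have b20 : 0 <= b2 by lra.
  apply: le_trans (ler_wpM2l b20 H) _.
  have := ler_wpM2l (mulr_ge0 b20 (sqr_ge0 (lam ^+ k))) (Hb1 (e 0%N)).
  lra.
(* Coercivity of [P] applied to the bound on [V], with [(1 - alpha)^k] replaced by 1. *)
- exists (fun e0 r => Num.sqrt (b2 * (quad_form P e0 + mu0 * r ^+ 2))); split.
    by move=> *; exact: sqrtr_ge0.
  move=> e w Te Hw k.
  have Ve0 := posdef_ge0 (e 0%N) Ppos.
  have b20 : 0 <= b2 by lra.
  have r0 : 0 <= mu0 * norm_Linf w ^+ 2 by rewrite mulr_ge0 ?sqr_ge0.
  apply: norm2_le; first exact: sqrtr_ge0.
  rewrite [leRHS]sqr_sqrtr ?mulr_ge0 ?addr_ge0 //.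
  apply: le_trans (Hb2 _) _; apply: ler_wpM2l => //.
  apply: le_trans (VT _ _ _ Te (norm2_le_norm_Linf Hw) k) _.
  rewrite lerD2r ler_piMl // exprn_ile1 //; lra.
- move=> e w Te Hw e0 k; apply: norm2_le.
    by rewrite mulr_ge0 ?sqrtr_ge0 // Linf0.
  (* The transient in [ZT] vanishes because [V 0 = 0]. *)
  have := ZT _ _ Te Hw k.
  by rewrite e0 quad_formE bil0r mulr0 mul0r add0r.
- move=> e w Te Hw; have Ve0 := posdef_ge0 (e 0%N) Ppos.
  (* [ZT] bounds the squared output by [c^2 + d^2] with [c, d >= 0], hence the output by [c + d],
     where [c] is geometric in [k] and [d] is the performance bound. *)
  apply: (@limn_esup_le_geometric _ _ (Num.sqrt (mu1 * quad_form P (e 0%N))) lam) => //.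
  move=> k.
  have c0 : 0 <= Num.sqrt (mu1 * quad_form P (e 0%N)) * lam ^+ k.
    by rewrite mulr_ge0 ?sqrtr_ge0 ?exprn_ge0.
  have d0 : 0 <= Num.sqrt (mu0 * mu1 + mu2) * norm_Linf w.
    by rewrite mulr_ge0 ?sqrtr_ge0 // Linf0.
  apply: norm2_le; first exact: addr_ge0.
  apply: le_trans (ZT _ _ Te Hw k) _.
  rewrite sqrrD [(_ * lam ^+ k) ^+ 2]exprMn [Num.sqrt (mu1 * _) ^+ 2]sqr_sqrtr.
    by have := mulr_ge0 c0 d0; lra.
  exact: mulr_ge0.
Qed.
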